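(* Let $\Phi\in\mathcal{E}(I)$. Then the class $\mathcal{A}_\Phi(I)$ is closed under pointwise chain infimum and pointwise chain supremum. Consequently, $\mathcal{A}_\Phi(I)$ is closed with respect to the pointwise limit operation, i.e., if $(f_n)$ is a sequence in $\mathcal{A}_\Phi(I)$ converging pointwise to a function $f:I\to\mathbb{R}$, then $f\in\mathcal{A}_\Phi(I)$.
   Context: $I\subseteq\mathbb{R}$ is a nonempty open interval and $\ell(I)\in(0,\infty]$ is its length. $\mathcal{E}(I)$ is the set of all functions $\Phi:[0,\ell(I))\to[0,\infty)$ (called error functions). For $\Phi\in\mathcal{E}(I)$, a function $f:I\to\mathbb{R}$ is called $\Phi$-affine if for all $x,y\in I$ and $t\in[0,1]$, $$|f(tx+(1-t)y)-tf(x)-(1-t)f(y)|\leq t\Phi((1-t)|x-y|)+(1-t)\Phi(t|x-y|).$$ $\mathcal{A}_\Phi(I)$ denotes the class of all $\Phi$-affine functions on $I$. A family $\{f_\gamma:I\to\mathbb{R}\mid\gamma\in\Gamma\}$ is a chain if for all $\alpha,\beta\in\Gamma$ either $f_\alpha\leq f_\beta$ or $f_\beta\leq f_\alpha$ holds on $I$. A class $\mathcal{F}$ of real-valued functions on $I$ is closed under pointwise chain supremum (resp. chain infimum) if, whenever $\{f_\gamma\mid\gamma\in\Gamma\}\subseteq\mathcal{F}$ is a chain whose pointwise supremum (resp. infimum) is a real-valued function $f:I\to\mathbb{R}$, then $f\in\mathcal{F}$. *)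

(* Defs.v *)
From mathcomp Require Import all_boot all_order all_algebra.
From mathcomp Require Import all_classical all_reals all_analysis.

Set Implicit Arguments.
Unset Strict Implicit.
Unset Printing Implicit Defensive.

Import Order.TTheory GRing.Theory Num.Theory.
Import numFieldNormedType.Exports.

Local Open Scope classical_set_scope.
Local Open Scope ring_scope.

(* Functions on I (resp. on [0, l(I)[) are represented by total functions
   R -> R, of which only the values on I (resp. on [0, l(I)[) are used.
   A class of functions on I is a set of such functions. *)

(* For nonempty I the supremum is not -oo and the infimum is not +oo, so the
   difference below is never of the form oo - oo. *)
Definition interval_length (R : realType) (I : set R) : \bar R :=
  (ereal_sup (EFin @` I) - ereal_inf (EFin @` I))%E.

Definition error_functions (R : realType) (I : set R) : set (R -> R) :=
  [set Phi | forall u : R,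
    0 <= u -> (u%:E < interval_length I)%E -> 0 <= Phi u].

(* For x, y in an open interval I and t in [0, 1], the point
   t * x + (1 - t) * y is in I, and both arguments of Phi are in
   [0, l(I)[. *)
Definition affine_functions (R : realType) (I : set R) (Phi : R -> R) :
    set (R -> R) :=
  [set f | forall x y t : R, I x -> I y -> 0 <= t <= 1 ->
    `| f (t * x + (1 - t) * y) - t * f x - (1 - t) * f y |
    <= t * Phi ((1 - t) * `|x - y|) + (1 - t) * Phi (t * `|x - y|)].

Definition is_chain (R : realType) (I : set R) (Gamma : Type)
    (f_ : Gamma -> R -> R) : Prop :=
  forall a b : Gamma,
    (forall x, I x -> f_ a x <= f_ b x) \/ (forall x, I x -> f_ b x <= f_ a x).

(* The supremum and the infimum are taken in the extended reals: requiring them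
   to be finite at the points of I excludes the empty family, as I is
   nonempty. *)
Definition closed_chain_sup (R : realType) (I : set R) (F : set (R -> R)) :
    Prop :=
  forall (Gamma : Type) (f_ : Gamma -> R -> R) (f : R -> R),
    (forall g, F (f_ g)) -> is_chain I f_ ->
    (forall x, I x -> ereal_sup (range (fun g => (f_ g x)%:E)) = (f x)%:E) ->
    F f.

Definition closed_chain_inf (R : realType) (I : set R) (F : set (R -> R)) :
    Prop :=
  forall (Gamma : Type) (f_ : Gamma -> R -> R) (f : R -> R),
    (forall g, F (f_ g)) -> is_chain I f_ ->
    (forall x, I x -> ereal_inf (range (fun g => (f_ g x)%:E)) = (f x)%:E) ->
    F f.

Definition closed_pointwise_limit (R : realType) (I : set R)
    (F : set (R -> R)) : Prop :=
  forall (f_ : nat -> R -> R) (f : R -> R),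
    (forall n, F (f_ n)) ->
    (forall x, I x -> f_ n x @[n --> \oo] --> f x) ->
    F f.

(* Main.v *)
Require Import Defs.
From mathcomp Require Import all_boot all_order all_algebra.
From mathcomp Require Import all_classical all_reals all_analysis.
From mathcomp Require Import ring lra.

Import Order.TTheory GRing.Theory Num.Theory.
Import numFieldNormedType.Exports.

Local Open Scope classical_set_scope.
Local Open Scope ring_scope.

(** For fixed x, y and t, the defining inequality of a Phi-affine function is a
    non-strict inequality that involves the function at three points only: x, y
    and t * x + (1 - t) * y. It therefore passes to any function that can be
    approximated on every triple of points of I, up to every e > 0, by a
    Phi-affine function which may depend on the triple and on e
    ([affine_functions_approx]).

    Pointwise limits have this property at once. So does the supremum of a
    chain: for each of the three points some member of the chain is e-close to
    the supremum there, and the largest of these three members is e-close at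
    all of them. Infima reduce to suprema, because the class is stable under
    f |-> - f. *)

Lemma is_interval_convex_combination (R : realType) (I : set R) (x y t : R) :
  is_interval I -> I x -> I y -> 0 <= t <= 1 -> I (t * x + (1 - t) * y).
Proof.
move=> Iitv Ix Iy /andP[t0 t1].
have s0 : 0 <= 1 - t by lra.
have [xy|/ltW yx] := leP x y.
- apply: (Iitv x y) => //; apply/andP; split.
  + by have := ler_wpM2l s0 xy; lra.
  + by have := ler_wpM2l t0 xy; lra.
- apply: (Iitv y x) => //; apply/andP; split.
  + by have := ler_wpM2l t0 yx; lra.
  + by have := ler_wpM2l s0 yx; lra.
Qed.

(** A perturbation of size at most e of the three values moves the affinity
    defect by at most e + t * e + (1 - t) * e = 2 * e. *)
Lemma affine_defect_perturb (R : realType) (t e z x y z' x' y' : R) :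
  0 <= t <= 1 -> `|z - z'| <= e -> `|x - x'| <= e -> `|y - y'| <= e ->
  `|z - t * x - (1 - t) * y| <= `|z' - t * x' - (1 - t) * y'| + e *+ 2.
Proof.
move=> /andP[t0 t1] hz hx hy.
have s0 : 0 <= 1 - t by lra.
have -> : z - t * x - (1 - t) * y = (z' - t * x' - (1 - t) * y') +
    ((z - z') - (t * (x - x') + (1 - t) * (y - y'))) by ring.
apply: (le_trans (ler_normD _ _)); rewrite lerD2l mulr2n.
apply: (le_trans (ler_normB _ _)); apply: lerD => //.
apply: (le_trans (ler_normD _ _)); rewrite !normrM (ger0_norm t0) (ger0_norm s0).
by have := ler_wpM2l t0 hx; have := ler_wpM2l s0 hy; lra.
Qed.

(** The right-hand side of the inequality depends on x, y and t but not on the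
    function, so it is the same for f and for all its approximations; letting
    the approximation error tend to 0 gives the bound for f. *)
Lemma affine_functions_approx (R : realType) (I : set R) (Phi f : R -> R) :
  is_interval I ->
  (forall x y z e, I x -> I y -> I z -> 0 < e ->
    exists2 g, affine_functions I Phi g &
      [/\ `|f x - g x| <= e, `|f y - g y| <= e & `|f z - g z| <= e]) ->
  affine_functions I Phi f.
Proof.
move=> Iitv fapprox x y t Ix Iy t01.
apply/ler_addgt0Pr => e e0.
have Iz := is_interval_convex_combination _ _ _ _ _ Iitv Ix Iy t01.
have e20 : 0 < e / 2 by rewrite divr_gt0.
have [g gaff [gx gy gz]] := fapprox _ _ _ _ Ix Iy Iz e20.
apply: le_trans (affine_defect_perturb _ _ _ _ _ _ _ _ _ t01 gz gx gy) _.
by rewrite -[_ *+ 2]mulr_natr divfK// lerD2r gaff.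
Qed.

Lemma affine_functionsN (R : realType) (I : set R) (Phi f : R -> R) :
  affine_functions I Phi f -> affine_functions I Phi (fun x => - f x).
Proof.
move=> faff x y t Ix Iy t01; rewrite -normrN.
by have := faff x y t Ix Iy t01; congr (`|_| <= _); ring.
Qed.

Lemma is_chain_upper_bound (R : realType) (I : set R) (Gamma : Type)
    (f_ : Gamma -> R -> R) (a b : Gamma) : is_chain I f_ ->
  exists c, forall x, I x -> f_ a x <= f_ c x /\ f_ b x <= f_ c x.
Proof.
move=> chain_f; have [ab|ba] := chain_f a b.
- by exists b => x Ix; split=> //; exact: ab.
- by exists a => x Ix; split=> //; exact: ba.
Qed.

Lemma closed_chain_sup_affine (R : realType) (I : set R) (Phi : R -> R) :
  is_interval I -> closed_chain_sup I (affine_functions I Phi).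
Proof.
move=> Iitv Gamma f_ f f_aff chain_f supf.
apply: affine_functions_approx => // x y z e Ix Iy Iz e0.
have f_le g u : I u -> f_ g u <= f u.
  by move=> Iu; rewrite -lee_fin -supf//; apply: ereal_sup_ubound; exists g.
have f_close u : I u -> exists g, f u - e < f_ g u.
  move=> Iu.
  have : ((f u - e)%:E < ereal_sup (range (fun g => (f_ g u)%:E)))%E.
    by rewrite supf// lte_fin ltrBlDr ltrDl.
  by move=> /ereal_sup_gt[_ [g _ <-]]; rewrite lte_fin => ?; exists g.
(* By the chain condition one member m lies above the members that are good at
   x, y and z, hence it is good at the three points simultaneously. *)
have [[a fa] [b fb] [c fc]] := And3 (f_close x Ix) (f_close y Iy) (f_close z Iz).
have [d abd] := is_chain_upper_bound _ _ _ _ a b chain_f.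
have [m dcm] := is_chain_upper_bound _ _ _ _ d c chain_f.
have close u g : I u -> f u - e < f_ g u -> f_ g u <= f_ m u ->
    `|f u - f_ m u| <= e.
  move=> Iu fg gm; rewrite ger0_norm ?subr_ge0 ?f_le//.
  by lra.
exists (f_ m) => //; split.
- apply: (close x a) => //; exact: le_trans (abd x Ix).1 (dcm x Ix).1.
- apply: (close y b) => //; exact: le_trans (abd y Iy).2 (dcm y Iy).1.
- by apply: (close z c) => //; exact: (dcm z Iz).2.
Qed.

Lemma closed_chain_inf_affine (R : realType) (I : set R) (Phi : R -> R) :
  is_interval I -> closed_chain_inf I (affine_functions I Phi).
Proof.
move=> Iitv Gamma f_ f f_aff chain_f inff.
have -> : f = (fun x => - - f x) by apply/funext => x; rewrite opprK.
apply: affine_functionsN.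
apply: (@closed_chain_sup_affine R I Phi Iitv Gamma (fun g x => - f_ g x)).
- by move=> g; exact: affine_functionsN.
- move=> a b; have [ab|ba] := chain_f a b.
  + by right=> x Ix; rewrite lerN2 ab.
  + by left=> x Ix; rewrite lerN2 ba.
- move=> x Ix; rewrite EFinN -inff// /ereal_inf oppeK; congr ereal_sup.
  by rewrite image_comp.
Qed.

Lemma closed_pointwise_limit_affine (R : realType) (I : set R) (Phi : R -> R) :
  is_interval I -> closed_pointwise_limit I (affine_functions I Phi).
Proof.
move=> Iitv f_ f f_aff f_cvg.
apply: affine_functions_approx => // x y z e Ix Iy Iz e0.
have near_f u : I u -> \forall n \near \oo, `|f u - f_ n u| <= e.
  by move=> Iu; have /cvgrPdist_le := f_cvg u Iu; exact.
have [n [nx [ny nz]]] : exists n, [/\ `|f x - f_ n x| <= e &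
    `|f y - f_ n y| <= e /\ `|f z - f_ n z| <= e].
  apply: (@filter_ex _ \oo).
  near=> n; split; [|split]; near: n; exact: near_f.
by exists (f_ n).
Unshelve. all: by end_near. Qed.

Theorem proposition2p7 (R : realType) (I : set R)
    (Iopen : open I) (Iitv : is_interval I) (Inonempty : I !=set0)
    (Phi : R -> R) (Phi_err : error_functions I Phi) :
  [/\ closed_chain_inf I (affine_functions I Phi),
      closed_chain_sup I (affine_functions I Phi)
    & closed_pointwise_limit I (affine_functions I Phi)].
Proof.
split.
- exact: closed_chain_inf_affine.
- exact: closed_chain_sup_affine.
- exact: closed_pointwise_limit_affine.
Qed.
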